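(* Let $T\colon M\to M$ be a nonuniformly expanding map (with the data $Y,\alpha,\tau,F,\lambda,\mu,K$ of the context), let $R'>K\lambda/(\lambda-1)$ be fixed, let $v\colon M\to\mathbb{R}^d$ be a bounded observable and $v_n=\sum_{k=0}^{n-1}v\circ T^k$. Let $\rho_1,\rho_2$ be two forward regular probability measures on $M$ with disintegrations $\rho_j=\int_{E_j}\rho_{j,z}\,d\varkappa_j(z)$ and jump functions $r_j$, $j=1,2$, and let $X_n=(v_n,\rho_1)$, $Y_n=(v_n,\rho_2)$. Suppose that for some constants $C_\beta>0$ and $\beta>1$, $$\varkappa_1(r_1\ge n)\le C_\beta n^{-\beta},\quad \varkappa_2(r_2\ge n)\le C_\beta n^{-\beta},\quad \mu(\tau\ge n)\le C_\beta n^{-\beta}\qquad\text{for all } n\ge1.$$ Let $C$ be the constant, described in the context, for which $\{X_n,n\ge 0\}$ and $\{Y_n,n\ge 0\}$ can be coupled with $\mathbb{P}(\sup_{n\ge0}|X_n-Y_n|\ge x)\le Cx^{-\beta}$ for all $x>0$. Then for each $n\ge0$ and $1\le p<\beta$, $$d_{LP}(X_n,Y_n)\le C_{LP}\qquad\text{and}\qquad d_{W,p}(X_n,Y_n)\le C_{W,p},$$ where the constants $C_{LP}$ and $C_{W,p}$ depend continuously (only) on $p$ and the constant $C$. In particular, they do not depend on $n$.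
   Context: Notation: $\mathbb{N}=\{1,2,\ldots\}$, $\mathbb{N}_0=\mathbb{N}\cup\{0\}$. For a measure $\nu$ and map $G$, $G_*\nu$ is the push-forward. Nonuniformly expanding maps. $(M,d)$ is a metric space with a Borel probability measure $m$, and $T\colon M\to M$ is a nonsingular transformation. There exist $Y\subset M$ with $m(Y)>0$, an at most countable partition $\alpha$ of $Y$ (modulo a zero measure set) and $\tau\colon Y\to\mathbb{N}$ (return time) with $\int_Y\tau\,dm<\infty$ such that for every $a\in\alpha$: $m(a)>0$; $\tau$ is constant on $a$ with value $\tau(a)$; $T^{\tau(a)}a\subset Y$. The induced map is $F\colon Y\to Y$, $Fy=T^{\tau(y)}y$. There are constants $\lambda>1$, $\hat K\ge0$ such that for each $a\in\alpha$ and $x,y\in a$: $F$ restricts to a (measure-theoretic) bijection from $a$ onto $Y$; $d(Fx,Fy)\ge\lambda d(x,y)$; the inverse Jacobian $\zeta_m=\frac{dm}{dm\circ F}$ of $F$ satisfies $|\log\zeta_m(x)-\log\zeta_m(y)|\le\hat K d(Fx,Fy)$. Standing normalization: $\operatorname{diam}Y\le1$. There is a unique $F$-invariant probability measure $\mu$ on $Y$ absolutely continuous with respect to $m$ (also viewed as a measure on $M$ supported on $Y$). Put $\zeta=\frac{d\mu}{d\mu\circ F}$. $K$ is a constant depending continuously (only) on $\lambda$ and $\hat K$ such that $K^{-1}\le\frac{d\mu}{dm}\le K$ on $Y$ and $|\log\zeta(x)-\log\zeta(y)|\le K d(Fx,Fy)$ for all $x,y\in a$, $a\in\alpha$ (such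 $K$ exists). For $\phi\colon Y\to(0,\infty)$ put $|\phi|_{d,\ell}=\sup_{x\ne y\in Y}\frac{|\log\phi(x)-\log\phi(y)|}{d(x,y)}$. Regular measure: a probability measure $\rho$ on $M$ supported on $Y$ with $d\rho=\phi\,d\mu$, where $\phi\colon Y\to(0,\infty)$ satisfies $|\phi|_{d,\ell}\le R'$. Forward regular measure: a probability measure $\rho$ on $M$ which allows a disintegration $\rho=\int_E\rho_z\,d\varkappa(z)$, where $(E,\varkappa)$ is a probability space and $\{\rho_z\}$ is a measurable family of probability measures on $M$, such that there is a (measurable) function $r\colon E\to\mathbb{N}_0$, called a jump function, such that $T_*^{r(z)}\rho_z$ is a regular measure for each $z\in E$. $(v_n,\nu)$ denotes the discrete time random process $\{v_n,n\ge0\}$ on the probability space $(M,\nu)$. The constant $C$: under the stated hypotheses there is a constant $C$, depending continuously (only) on $\lambda,K,R',\beta,C_\beta$ and $|v|_\infty=\sup_{x\in M}|v(x)|$, such that the processes $\{X_n,n\ge0\}$ and $\{Y_n,n\ge0\}$ can be redefined (keeping the distribution of each process) on a common probability space $(\Omega,\mathbb{P})$ so that $Z=\sup_{n\ge0}|X_n-Y_n|$ is almost surely finite and $\mathbb{P}(Z\ge x)\le Cx^{-\beta}$ for all $x>0$. For $\mathbb{R}^d$-valued random variables $X,Y$ with laws $\mathbb{P}_X,\mathbb{P}_Y$, the Lévy-Prokhorov distance is $$d_{LP}(X,Y)=\inf\{\varepsilon>0\colon \mathbb{P}_X(A)\le\mathbb{P}_Y(A^\varepsilon)+\varepsilon\text{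 and }\mathbb{P}_Y(A)\le\mathbb{P}_X(A^\varepsilon)+\varepsilon\text{ for all Borel }A\subset\mathbb{R}^d\},$$ where $A^\varepsilon=\{x\colon\inf_{y\in A}|x-y|\le\varepsilon\}$. For $p\ge1$ the $p$-th Wasserstein distance is $d_{W,p}(X,Y)=\inf[\mathbb{E}(|X-Y|^p)]^{1/p}$, the infimum over all couplings of $X$ and $Y$.
   Formalization: The constant C_{W,p} is allowed to depend on β as well as on p and C (continuously in p and C for each fixed β), since a bound independent of β fails as β decreases to p. *)

(* Defs.v *)
From HB Require Import structures.
From mathcomp Require Import all_boot all_order all_algebra.
From mathcomp Require Import all_classical all_reals all_analysis.

Set Implicit Arguments.
Unset Strict Implicit.
Unset Printing Implicit Defensive.

Import Order.TTheory GRing.Theory Num.Theory.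
Import numFieldNormedType.Exports.

Local Open Scope classical_set_scope.
Local Open Scope ring_scope.

(* Measurable types of the library are pointed, metric types are not. *)
#[short(type="pointedMetricType")]
HB.structure Definition PointedMetric (K : numDomainType) :=
  { M of Metric K M & isPointed M }.

Notation borel T := (g_sigma_algebraType (@open T)).

(* d nu = f d mu on D. The base mu is only used on measurable subsets of D, so
   it need not be a measure elsewhere (see [inverse_jacobian]). *)
Definition density d (X : measurableType d) (R : realType) (D : set X)
    (nu mu : set X -> \bar R) (f : X -> R) : Prop :=
  [/\ measurable_fun D f, (forall x, D x -> 0 <= f x) &
      forall A, measurable A -> A `<=` D ->
        nu A = (\int[mu]_(x in A) (f x)%:E)%E].

(* F is a bimeasurable bijection from A' onto B', which are A and B up to
   nu-null sets. *)
Record bij_mod0 d (X : measurableType d) (R : realType)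
    (nu : set X -> \bar R) (F : X -> X) (A B A' B' : set X) : Prop := {
  bij_mod0_dom : [/\ measurable A', A' `<=` A & nu (A `\` A') = 0%E];
  bij_mod0_cod : [/\ measurable B', B' `<=` B & nu (B `\` B') = 0%E];
  bij_mod0_bij : set_bij A' B' F;
  bij_mod0_measurable : measurable_fun A' F;
  bij_mod0_image : forall E, measurable E -> E `<=` A' -> measurable (F @` E)
}.

Definition measure_bijection d (X : measurableType d) (R : realType)
    (nu : set X -> \bar R) (F : X -> X) (A B : set X) : Prop :=
  exists A' B', bij_mod0 nu F A B A' B'.

(* zeta = d nu / d (nu o F) on A, where (nu o F)(E) = nu (F E). *)
Definition inverse_jacobian d (X : measurableType d) (R : realType)
    (nu : set X -> \bar R) (F : X -> X) (A B : set X) (zeta : X -> R) : Prop :=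
  exists A' B', bij_mod0 nu F A B A' B' /\
    density A' nu (fun E => nu (F @` E)) zeta.

Definition jacobian_log_lipschitz (R : realType) (M : pointedMetricType R)
    (nu : set (borel M) -> \bar R) (Y : set M) (alpha : set (set M))
    (F : M -> M) (K : R) : Prop :=
  exists zeta : M -> R, forall a, alpha a ->
    [/\ @inverse_jacobian _ (borel M) R nu F a Y zeta,
        (forall x, a x -> 0 < zeta x) &
        forall x y, a x -> a y ->
          `|ln (zeta x) - ln (zeta y)| <= K * mdist (F x) (F y)].

Definition induced_map (M : Type) (T : M -> M) (tau : M -> nat) : M -> M :=
  fun y => iter (tau y) T y.

Record nonuniformly_expanding (R : realType) (M : pointedMetricType R)
    (m : probability (borel M) R) (T : borel M -> borel M)
    (Y : set (borel M)) (alpha : set (set (borel M))) (tau : borel M -> nat)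
    (lambda Khat : R) : Prop := {
  T_measurable : measurable_fun setT T;
  T_nonsingular : pushforward m T `<< m;
  Y_measurable : measurable Y;
  Y_gt0 : (0 < m Y)%E;
  alpha_countable : countable alpha;
  alpha_measurable : forall a, alpha a -> measurable a;
  alpha_sub : forall a, alpha a -> a `<=` Y;
  alpha_disjoint : trivIset alpha id;
  alpha_cover : m (Y `\` \bigcup_(a in alpha) a) = 0%E;
  alpha_gt0 : forall a, alpha a -> (0 < m a)%E;
  tau_gt0 : forall y, Y y -> (0 < tau y)%N;
  tau_measurable : measurable_fun Y tau;
  tau_integrable : (\int[m]_(y in Y) ((tau y)%:R)%:E < +oo)%E;
  tau_constant : forall a x y, alpha a -> a x -> a y -> tau x = tau y;
  tau_return : forall a, alpha a -> induced_map T tau @` a `<=` Y;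
  lambda_gt1 : 1 < lambda;
  Khat_ge0 : 0 <= Khat;
  F_bijection : forall a, alpha a -> measure_bijection m (induced_map T tau) a Y;
  F_expanding : forall a (x y : M), alpha a -> a x -> a y ->
    lambda * mdist x y <= mdist (induced_map T tau x : M) (induced_map T tau y);
  F_distortion : jacobian_log_lipschitz m Y alpha (induced_map T tau) Khat;
  Y_diam : forall x y : M, Y x -> Y y -> mdist x y <= 1
}.

Record invariant_acp (R : realType) (M : pointedMetricType R)
    (m : probability (borel M) R) (Y : set (borel M))
    (F : borel M -> borel M) (mu : probability (borel M) R) : Prop := {
  acp_supported : mu (~` Y) = 0%E;
  acp_invariant : forall A, measurable A -> mu (Y `&` F @^-1` A) = mu A;
  acp_dominated : mu `<< m
}.

Record regularity_constant (R : realType) (M : pointedMetricType R)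
    (m : probability (borel M) R) (Y : set (borel M))
    (alpha : set (set (borel M))) (F : borel M -> borel M)
    (mu : probability (borel M) R) (K : R) : Prop := {
  regularity_gt0 : 0 < K;
  regularity_density : exists h : borel M -> R,
    density Y mu m h /\ forall y, Y y -> K^-1 <= h y <= K;
  regularity_jacobian : jacobian_log_lipschitz mu Y alpha F K
}.

Definition log_lipschitz_seminorm (R : realType) (M : pointedMetricType R)
    (Y : set M) (phi : M -> R) : \bar R :=
  ereal_sup [set z | exists x y, [/\ Y x, Y y, x <> y &
    z = (`|ln (phi x) - ln (phi y)| / mdist x y)%:E]].

Definition regular_measure (R : realType) (M : pointedMetricType R)
    (Y : set (borel M)) (mu : probability (borel M) R) (R' : R)
    (rho : set (borel M) -> \bar R) : Prop :=
  rho setT = 1%E /\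
  exists phi : borel M -> R,
    [/\ measurable_fun Y phi, (forall y, Y y -> 0 < phi y),
        (@log_lipschitz_seminorm R M Y phi <= R'%:E)%E &
        forall A, measurable A ->
          rho A = (\int[mu]_(x in A `&` Y) (phi x)%:E)%E].

Record forward_regular (R : realType) (M : pointedMetricType R)
    (T : borel M -> borel M) (Y : set (borel M))
    (mu : probability (borel M) R) (R' : R) (rho : probability (borel M) R)
    d (E : measurableType d) (kappa : probability E R)
    (rhoz : R.-pker E ~> borel M) (r : E -> nat) : Prop := {
  disintegration : forall A, measurable A ->
    rho A = (\int[kappa]_z rhoz z A)%E;
  jump_measurable : measurable_fun setT r;
  jump_regular : forall z,
    regular_measure Y mu R' (pushforward (rhoz z) (iter (r z) T))
}.

(* The norm provided by the library on row vectors is the sup norm. *)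
Definition enorm (R : realType) (n : nat) (x : 'rV[R]_n) : R :=
  Num.sqrt (\sum_(i < n) x 0 i ^+ 2).

Definition birkhoff_sum (R : realType) (M : Type) (n : nat)
    (T : M -> M) (v : M -> 'rV[R]_n) (N : nat) (x : M) : 'rV[R]_n :=
  \sum_(k < N) v (iter k T x).

Definition cylinders d (X : measurableType d) : set (set (nat -> X)) :=
  [set C | exists n (B : set X), measurable B /\ C = [set w | B (w n)]].

(* Equality of the laws on the product sigma-algebra of X^nat. *)
Definition same_process_law d1 (S1 : measurableType d1)
    d2 (S2 : measurableType d2) d (X : measurableType d) (R : realType)
    (P1 : set S1 -> \bar R) (P2 : set S2 -> \bar R)
    (U : nat -> S1 -> X) (V : nat -> S2 -> X) : Prop :=
  forall C, <<s @cylinders _ X >> C ->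
    P1 [set w | C (U ^~ w)] = P2 [set w | C (V ^~ w)].

Definition coupled_with_tail (R : realType) (n : nat)
    d1 (S1 : measurableType d1) d2 (S2 : measurableType d2)
    (P1 : probability S1 R) (P2 : probability S2 R)
    (U : nat -> S1 -> 'rV[R]_n) (V : nat -> S2 -> 'rV[R]_n)
    (beta C : R) : Prop :=
  exists (d : measure_display) (Om : measurableType d) (P : probability Om R)
         (U' V' : nat -> Om -> borel 'rV[R]_n),
  let Z w := ereal_sup
    (range (fun k => (enorm ((U' k w : 'rV[R]_n) - V' k w))%:E)) in
  [/\ forall k, measurable_fun setT (U' k) /\ measurable_fun setT (V' k),
      @same_process_law _ _ _ _ _ (borel 'rV[R]_n) _ P P1 U' U,
      @same_process_law _ _ _ _ _ (borel 'rV[R]_n) _ P P2 V' V,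
      {ae P, forall w, (Z w < +oo)%E} &
      forall x : R, 0 < x ->
        (P [set w | (x%:E <= Z w)%E] <= (C * x `^ (- beta))%:E)%E].

Definition fattening (R : realType) (n : nat) (A : set 'rV[R]_n) (e : R) :
    set 'rV[R]_n :=
  [set x | (ereal_inf [set (enorm (x - y))%:E | y in A] <= e%:E)%E].

Definition levy_prokhorov (R : realType) (n : nat)
    (P Q : set (borel 'rV[R]_n) -> \bar R) : \bar R :=
  ereal_inf [set e%:E | e in [set e : R | 0 < e /\
    forall A : set (borel 'rV[R]_n), measurable A ->
      (P A <= Q (fattening A e) + e%:E)%E /\
      (Q A <= P (fattening A e) + e%:E)%E]].

Definition wasserstein (R : realType) (n : nat) (p : R)
    (P Q : set (borel 'rV[R]_n) -> \bar R) : \bar R :=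
  ereal_inf [set c | exists
    pi : probability (borel 'rV[R]_n * borel 'rV[R]_n)%type R,
    [/\ forall A, measurable A -> pi (A `*` setT) = P A,
        forall B, measurable B -> pi (setT `*` B) = Q B &
        c = poweR (\int[pi]_w
              (enorm ((w.1 : 'rV[R]_n) - w.2) `^ p)%:E)%E p^-1]].

(* Main.v *)
Require Import Defs.
From HB Require Import structures.
From mathcomp Require Import all_boot all_order all_algebra.
From mathcomp Require Import all_classical all_reals all_analysis.
From mathcomp Require Import ring.
From mathcomp Require Import measurable_realfun.

Set Implicit Arguments.
Unset Strict Implicit.
Unset Printing Implicit Defensive.

Import Order.TTheory GRing.Theory Num.Theory.
Import numFieldNormedType.Exports.
Local Open Scope classical_set_scope.
Local Open Scope ring_scope.

(** The dynamics enter only through the coupling: the vectors [U n] and [V n] of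
the coupled processes have the laws of the Birkhoff sums under [rho1] and
[rho2] ([same_process_law_marginal]), and their distance [W n] is at most [Z],
so that it inherits the tail [C * x `^ (- beta)] ([sup_tail_le]).

Wasserstein distance. The joint law of [(U n, V n)] is an admissible coupling
([wasserstein_le_coupling]), so the p-th moment of [W n] has to be bounded by
a function of [p] and [C]. Cutting the values of [W n] at the powers of two,
  [W n `^ p <= 1 + \sum_k (2 `^ p) ^+ k.+1 * (2 ^+ k <= W n)]
([dyadic_bound]); taking expectations, the tail turns the sum into a geometric
series of ratio [2 `^ (p - beta)], which converges exactly when [p < beta]
([moment_le_of_tail]). Its sum is continuous in [(p, C)], and so is its root of
order [p], because the ratio stays below 1 and the sum above 0
([continuous_moment_constant_root]).

Levy-Prokhorov distance. For fixed [beta] the coupling gives the bound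
[C `^ (beta + 1)^-1], since [P (Z >= e) <= C * e `^ (- beta) = e] for that value
of [e]. But one constant has to serve all [beta > 1], and for [0 < C <= 1] the
supremum of these bounds over [beta] is 1, while two probability laws are never
at distance greater than 1 ([levy_prokhorov_le1]). Hence the constant
function 1. *)

(** * Continuity of the constants *)

Lemma cvg_powR (R : realType) (T : Type) (F : set_system T) (FF : Filter F)
    (f g : T -> R) (a b : R) :
  0 < a -> f @ F --> a -> g @ F --> b -> (fun x => f x `^ g x) @ F --> a `^ b.
Proof.
move=> a0 fa gb.
have -> : a `^ b = expR (b * ln a) by rewrite /powR gt_eqF.
have lnf : (fun x => ln (f x)) @ F --> ln a.
  by apply: continuous_cvg fa; exact: continuous_ln.
have h : (fun x => expR (g x * ln (f x))) @ F --> expR (b * ln a).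
  by apply: continuous_cvg (cvgM gb lnf); exact: continuous_expR.
apply: cvg_trans h; apply: near_eq_cvg.
have f_gt0 : \forall x \near F, 0 < f x by exact: cvgr_gt fa _ a0.
by apply: filterS f_gt0 => x fx0; rewrite /powR gt_eqF.
Qed.

(** The summand 1 accounts for the values of the variable below 1, the quotient
is the sum of the geometric series coming from the dyadic levels above 1. *)
Definition moment_constant (R : realType) (beta p C : R) : R :=
  1 + C * 2 `^ p / (1 - 2 `^ (p - beta)).

Lemma powR2_lt1 (R : realType) (x : R) : x < 0 -> 2 `^ x < 1 :> R.
Proof.
move=> x0; rewrite -[ltRHS](powRr0 2) /powR !gt_eqF// ltr_expR.
by rewrite mul0r nmulr_rlt0// ln_gt0// ltr1n.
Qed.

Lemma moment_constant_gt0 (R : realType) (beta p C : R) :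
  p < beta -> 0 <= C -> 0 < moment_constant beta p C.
Proof.
move=> pb C0; rewrite ltr_pwDl// mulr_ge0 ?mulr_ge0 ?powR_ge0//.
by rewrite invr_ge0 subr_ge0 ltW// powR2_lt1// subr_lt0.
Qed.

Lemma continuous_moment_constant_root (R : realType) (beta : R) :
  {within [set pC : R * R | [/\ 1 <= pC.1, pC.1 < beta & 0 <= pC.2]],
    continuous (fun pC : R * R => moment_constant beta pC.1 pC.2 `^ pC.1^-1)}.
Proof.
apply: continuous_in_subspaceT => -[p C] /set_mem/= [p1 pb C0].
have cp : (fun x : R * R => x.1) @ (p, C) --> p by exact: cvg_fst.
have cC : (fun x : R * R => x.2) @ (p, C) --> C by exact: cvg_snd.
have c2 : (fun=> 2 : R) @ (p, C) --> (2 : R) by exact: cvg_cst.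
apply: cvg_powR.
- exact: moment_constant_gt0.
- apply: cvgD; first exact: cvg_cst.
  apply: cvgM; first by apply: cvgM => //; exact: cvg_powR.
  apply: cvgV; first by rewrite gt_eqF// subr_gt0 powR2_lt1// subr_lt0.
  apply: cvgB; first exact: cvg_cst.
  by apply: cvg_powR => //; apply: cvgB => //; exact: cvg_cst.
- by apply: cvgV => //; rewrite gt_eqF// (lt_le_trans ltr01).
Qed.

(** * Moments from a polynomial tail *)

(** If [2 ^+ k <= x < 2 ^+ k.+1], then the term of index [k] alone dominates
[x `^ p]. Unlike the integral formula for moments, this leaves a sum of
probabilities of events to which the tail bound applies directly. *)
Lemma dyadic_bound (R : realType) (p x : R) : 0 < p -> 0 <= x ->
  ((x `^ p)%:E <= 1 + \sum_(0 <= k <oo)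
     (((2 `^ p) ^+ k.+1)%:E * (2 ^+ k <= x)%R%:R%:E))%E.
Proof.
move=> p0 x0.
have term_ge0 k : (0 <= ((2 `^ p) ^+ k.+1)%:E * (2 ^+ k <= x)%R%:R%:E)%E.
  by rewrite -EFinM lee_fin mulr_ge0 ?exprn_ge0 ?powR_ge0.
have [x1|x1] := leP x 1.
  rewrite -[leLHS]adde0 leeD ?nneseries_ge0// lee_fin.
  have -> : 1 = 1 `^ p :> R by rewrite powR1.
  by rewrite ge0_ler_powR ?nnegrE// ltW.
(* The dyadic level of x is k, where k.+1 is the least N with x < 2 ^+ N; this
   N is positive because 1 < x. *)
have [N xN] : exists N, x < 2 ^+ N :> R.
  exists (Num.truncn x).+1; apply: (lt_le_trans (truncnS_gt x)).
  by rewrite -natrX ler_nat ltnW// ltn_expl.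
have {N xN} [N xN minN] := ex_minnP (ex_intro (fun N => x < 2 ^+ N) N xN).
case: N xN minN => [|k xk mink]; first by rewrite expr0 ltNge ltW.
have kx : 2 ^+ k <= x by rewrite leNgt; apply/negP => /mink; rewrite ltnn.
rewrite -[leLHS]add0e leeD//.
apply: (le_trans _ (nneseries_lim_ge k.+1 _)) => //.
rewrite big_nat_recr//= -[leLHS]add0e leeD ?sume_ge0//.
rewrite kx mule1 lee_fin -powR_mulrn ?powR_ge0// -powRrM mulrC powRrM.
by rewrite powR_mulrn// ge0_ler_powR ?nnegrE ?exprn_ge0// ltW.
Qed.

(** The dyadic level [k] contributes at most
[(2 `^ p) ^+ k.+1 * C * (2 ^+ k) `^ (- beta)], that is
[C * 2 `^ p * (2 `^ (p - beta)) ^+ k]. *)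
Lemma moment_le_of_tail (R : realType) d (Om : measurableType d)
    (P : probability Om R) (W : Om -> R) (beta C p : R) :
  0 < p -> p < beta -> 0 <= C ->
  measurable_fun setT W -> (forall w, 0 <= W w) ->
  (forall x, 0 < x -> (P [set w | (x <= W w)%R] <= (C * x `^ (- beta))%:E)%E) ->
  (\int[P]_w (W w `^ p)%:E <= (moment_constant beta p C)%:E)%E.
Proof.
move=> p0 pb C0 mW W0 tail.
pose A k := [set w | 2 ^+ k <= W w].
have mA k : measurable (A k).
  have := mW measurableT _ (measurable_itv `[(2 ^+ k : R), +oo[).
  rewrite setTI; congr measurable; apply/seteqP.
  by split=> w /=; rewrite in_itv/= andbT.
pose t k w : \bar R := (((2 `^ p) ^+ k.+1)%:E * (\1_(A k) w)%:E)%E.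
have mt k : measurable_fun [set: Om] (t k).
  by apply: measurable_funeM; apply/measurable_EFinP; exact: measurable_indic.
have t_ge0 k w : (0 <= t k w)%E.
  by rewrite /t -EFinM lee_fin mulr_ge0 ?exprn_ge0 ?powR_ge0.
have z_lt1 : 2 `^ (p - beta) < 1 :> R by rewrite powR2_lt1// subr_lt0.
apply: (@le_trans _ _ (\int[P]_w (1 + \sum_(0 <= k <oo) t k w))%E).
  apply: ge0_le_integral => //.
  - by move=> w _; rewrite lee_fin powR_ge0.
  - apply/measurable_EFinP.
    exact: (measurableT_comp (measurable_powR p) mW).
  - by apply: emeasurable_funD => //; apply: ge0_emeasurable_sum.
  - move=> w _; apply: (le_trans (@dyadic_bound R p (W w) p0 (W0 w))).
    rewrite leeD2l// le_eqVlt; apply/orP; left; apply/eqP.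
    apply: eq_eseriesr => k _; rewrite /t indicE.
    have -> // : (w \in A k) = (2 ^+ k <= W w).
    by apply/idP/idP => [/set_mem|h] //; apply/mem_set.
rewrite ge0_integralD//; last 2 first.
  by move=> w _; exact: nneseries_ge0.
  by apply: ge0_emeasurable_sum.
rewrite integral_cst// mul1e.
rewrite [X in (X + _)%E](probability_setT P : _ = 1%E).
rewrite /moment_constant EFinD leeD2l//.
rewrite integral_nneseries//.
apply: lime_le; first by apply: is_cvg_nneseries => k _ _; exact: integral_ge0.
apply: nearW => n.
apply: (@le_trans _ _ (series (geometric (C * 2 `^ p) (2 `^ (p - beta))) n)%:E).
  rewrite seriesEnat -sumEFin; apply: lee_sum => k _.
  rewrite /t ge0_integralZl_EFin ?exprn_ge0 ?powR_ge0//; last first.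
    by apply/measurable_EFinP; exact: measurable_indic.
  rewrite integral_indic// setIT.
  have k2 : 0 < 2 ^+ k :> R by rewrite exprn_gt0.
  apply: (le_trans (lee_pmul _ _ (lexx _) (tail _ k2))) => //.
  have pow2k : (2 ^+ k) `^ (- beta) = (2 `^ (- beta)) ^+ k :> R.
    by rewrite -!powR_mulrn ?powR_ge0// -!powRrM mulrC.
  rewrite pow2k -EFinM lee_fin/= powRD; last by rewrite pnatr_eq0 implybT.
  by rewrite exprMn exprS le_eqVlt; apply/orP; left; apply/eqP; ring.
rewrite lee_fin geometric_le_lim ?mulr_ge0 ?powR_ge0// ?powR_gt0//.
by rewrite ger0_norm ?powR_ge0.
Qed.

(** * Distances of laws from couplings *)

Lemma measurable_coord (R : realType) (n : nat) (i : 'I_n) :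
  measurable_fun [set: borel 'rV[R]_n] (fun x : borel 'rV[R]_n => (x : 'rV[R]_n) 0 i).
Proof.
apply: (measurability _ (RGenOpens.measurableE R)).
move=> _ [_ [a [b ->]] <-]; rewrite setTI; apply: sub_sigma_algebra.
exact: (open_comp (fun x _ => @coord_continuous R 1 n 0 i x)) (itv_open _ _).
Qed.

(** The sigma-algebra on pairs is the product of the Borel ones, not the Borel
sigma-algebra of the product, so continuity of the distance is not enough:
measurability is obtained coordinate by coordinate. *)
Lemma measurable_enorm_diff (R : realType) (n : nat) :
  measurable_fun [set: (borel 'rV[R]_n * borel 'rV[R]_n)%type]
    (fun w => enorm ((w.1 : 'rV[R]_n) - w.2)).
Proof.
apply: measurableT_comp.
  by apply: continuous_measurable_fun; exact: sqrt_continuous.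
apply: measurable_sum => i; apply: measurable_funX.
under eq_fun do rewrite !mxE.
by apply: measurable_funB; apply: measurableT_comp (measurable_coord i) _.
Qed.

Lemma wasserstein_le_coupling (R : realType) (n : nat) d (Om : measurableType d)
    (P : probability Om R) (U V : Om -> borel 'rV[R]_n)
    (mu nu : set (borel 'rV[R]_n) -> \bar R) (p : R) :
  measurable_fun setT U -> measurable_fun setT V ->
  (forall A, measurable A -> P (U @^-1` A) = mu A) ->
  (forall A, measurable A -> P (V @^-1` A) = nu A) ->
  (wasserstein p mu nu <=
   poweR (\int[P]_w (enorm ((U w : 'rV[R]_n) - V w) `^ p)%:E)%E p^-1)%E.
Proof.
move=> mU mV Pmu Pnu; apply: ereal_inf_lbound.
have mUV : measurable_fun setT (fun w => (U w, V w)).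
  exact: measurable_fun_pair.
pose UV : {mfun Om >-> (borel 'rV[R]_n * borel 'rV[R]_n)%type} :=
  HB.pack (fun w => (U w, V w)) (isMeasurableFun.Build _ _ _ _ _ mUV).
exists (distribution P UV); split.
- move=> A mA; rewrite -Pmu//; congr (P _).
  by apply/seteqP; split => w //= [].
- move=> A mA; rewrite -Pnu//; congr (P _).
  by apply/seteqP; split => w //= [].
congr poweR; rewrite ge0_integral_pushforward//.
- apply/measurable_EFinP.
  exact: (measurableT_comp (measurable_powR p) (@measurable_enorm_diff R n)).
- by move=> w _; rewrite lee_fin powR_ge0.
Qed.

(** [e = 1] is admissible: both inequalities then hold because the left-hand
side is at most 1. *)
Lemma levy_prokhorov_le1 (R : realType) (n : nat)
    (mu nu : set (borel 'rV[R]_n) -> \bar R) :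
  (forall A, 0 <= mu A)%E -> (forall A, 0 <= nu A)%E ->
  (forall A, measurable A -> mu A <= 1)%E ->
  (forall A, measurable A -> nu A <= 1)%E ->
  (levy_prokhorov mu nu <= 1)%E.
Proof.
move=> mu0 nu0 mu1 nu1; apply: ereal_inf_lbound; exists 1 => //; split=> // A mA.
by split; rewrite -[leLHS]add0e leeD// ?mu1 ?nu1.
Qed.

Lemma same_process_law_marginal (R : realType) d1 (S1 : measurableType d1)
    d2 (S2 : measurableType d2) d (X : measurableType d)
    (P1 : set S1 -> \bar R) (P2 : set S2 -> \bar R)
    (U : nat -> S1 -> X) (V : nat -> S2 -> X) (n : nat) (A : set X) :
  same_process_law P1 P2 U V -> measurable A ->
  P1 (U n @^-1` A) = P2 (V n @^-1` A).
Proof.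
move=> law mA; apply: (law [set w | A (w n)]); apply: sub_sigma_algebra.
by exists n, A.
Qed.

(** Monotonicity of [P] needs the event on the supremum to be measurable; this
holds because a supremum of countably many measurable functions is
measurable. *)
Lemma sup_tail_le (R : realType) d (Om : measurableType d)
    (P : probability Om R) (W : nat -> Om -> R) (x b : R) (n : nat) :
  (forall k, measurable_fun setT (W k)) ->
  (P [set w | (x%:E <= ereal_sup (range (fun k => (W k w)%:E)))%E] <= b%:E)%E ->
  (P [set w | (x <= W n w)%R] <= b%:E)%E.
Proof.
move=> mW; apply: le_trans; apply: le_measure; rewrite ?inE.
- have := mW n measurableT _ (measurable_itv `[x, +oo[).
  rewrite setTI; congr measurable; apply/seteqP.
  by split=> w /=; rewrite in_itv/= andbT.
- pose Z w := ereal_sup (range (fun k => (W k w)%:E)).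
  have mZ : measurable_fun setT Z.
    have -> : Z = fun w => esups (fun k => (W k w)%:E) 0.
      apply/funext => w; congr ereal_sup.
      by apply/seteqP; split=> _ [k _ <-]; exists k.
    by apply: measurable_fun_esups => k; exact/measurable_EFinP.
  have := mZ measurableT _ (emeasurable_itv `[x%:E, +oo[).
  rewrite setTI; congr measurable; apply/seteqP; split=> w /=.
    by rewrite in_itv/= andbT.
  by rewrite in_itv/= andbT.
- move=> w /= xW; apply: (@le_trans _ _ (W n w)%:E); first by rewrite lee_fin.
  by apply: ereal_sup_ubound; exists n.
Qed.

(** * The uniform bounds *)

Theorem corollary3p3 (R : realType) :
  exists C_LP : R -> R,
  {within [set C | 0 <= C], continuous C_LP} /\
  forall beta : R, 1 < beta ->
  exists C_W : R -> R -> R,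
  {within [set pC : R * R | [/\ 1 <= pC.1, pC.1 < beta & 0 <= pC.2]],
    continuous (fun pC : R * R => C_W pC.1 pC.2)} /\
  forall (M : pointedMetricType R) (m : probability (borel M) R)
    (T : borel M -> borel M) (Y : set (borel M))
    (alpha : set (set (borel M))) (tau : borel M -> nat) (lambda Khat : R),
  nonuniformly_expanding m T Y alpha tau lambda Khat ->
  forall mu : probability (borel M) R,
  invariant_acp m Y (induced_map T tau) mu ->
  forall K : R, regularity_constant m Y alpha (induced_map T tau) mu K ->
  forall R' : R, K * lambda / (lambda - 1) < R' ->
  forall (dim : nat) (v : borel M -> borel 'rV[R]_dim),
  measurable_fun setT v ->
  (exists B : R, forall x, enorm (v x) <= B) ->
  forall (rho1 rho2 : probability (borel M) R)
    (d1 : measure_display) (E1 : measurableType d1) (kappa1 : probability E1 R)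
    (rhoz1 : R.-pker E1 ~> borel M) (r1 : E1 -> nat)
    (d2 : measure_display) (E2 : measurableType d2) (kappa2 : probability E2 R)
    (rhoz2 : R.-pker E2 ~> borel M) (r2 : E2 -> nat),
  forward_regular T Y mu R' rho1 kappa1 rhoz1 r1 ->
  forward_regular T Y mu R' rho2 kappa2 rhoz2 r2 ->
  forall C_beta : R, 0 < C_beta ->
  (forall n : nat, (1 <= n)%N ->
    [/\ (kappa1 [set z | (n <= r1 z)%N] <= (C_beta * n%:R `^ (- beta))%:E)%E,
        (kappa2 [set z | (n <= r2 z)%N] <= (C_beta * n%:R `^ (- beta))%:E)%E &
        (mu (Y `&` [set y | (n <= tau y)%N])
           <= (C_beta * n%:R `^ (- beta))%:E)%E]) ->
  forall C : R,
  coupled_with_tail rho1 rho2 (birkhoff_sum T v) (birkhoff_sum T v) beta C ->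
  forall n : nat,
  let S : borel M -> borel 'rV[R]_dim := birkhoff_sum T v n in
  (levy_prokhorov (pushforward rho1 S) (pushforward rho2 S) <= (C_LP C)%:E)%E /\
  forall p : R, 1 <= p -> p < beta ->
    (wasserstein p (pushforward rho1 S) (pushforward rho2 S) <= (C_W p C)%:E)%E.
Proof.
exists (cst 1); split; first by move=> ?; exact: cvg_cst.
move=> beta beta1.
exists (fun p C => moment_constant beta p C `^ p^-1).
split; first exact: continuous_moment_constant_root.
move=> M m T Y alpha tau lambda Khat _ mu _ K _ R' _ dim v _ _.
move=> rho1 rho2 d1 E1 kappa1 rhoz1 r1 d2 E2 kappa2 rhoz2 r2 _ _ Cb _ _ C.
move=> [d [Om [P [U [V [mUV lawU lawV _ tail]]]]]] n S.
have margU A : measurable A -> P (U n @^-1` A) = rho1 (S @^-1` A).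
  exact: same_process_law_marginal.
have margV A : measurable A -> P (V n @^-1` A) = rho2 (S @^-1` A).
  exact: same_process_law_marginal.
have [mU mV] := mUV n.
have mpre (W : Om -> borel 'rV[R]_dim) A :
    measurable_fun setT W -> measurable A -> measurable (W @^-1` A).
  by move=> mW mA; rewrite -[_ @^-1` _]setTI; exact: mW.
split.
  apply: levy_prokhorov_le1 => [A|A|A mA|A mA].
  - exact: (measure_ge0 rho1 (S @^-1` A)).
  - exact: (measure_ge0 rho2 (S @^-1` A)).
  - have := probability_le1 P (mpre _ _ mU mA).
    by rewrite margU.
  - have := probability_le1 P (mpre _ _ mV mA).
    by rewrite margV.
move=> p p1 pb.
have p0 : 0 < p by exact: lt_le_trans p1.
pose W k w := enorm ((U k w : 'rV[R]_dim) - V k w).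
have mW k : measurable_fun setT (W k).
  have [mUk mVk] := mUV k.
  exact: (measurableT_comp (@measurable_enorm_diff R dim)
           (measurable_fun_pair mUk mVk)).
have tailW x : 0 < x -> (P [set w | (x <= W n w)%R] <= (C * x `^ (- beta))%:E)%E.
  by move=> x0; apply: sup_tail_le => //; exact: tail.
(* The tail bound at x = 1 dominates a probability. *)
have C0 : 0 <= C.
  have := le_trans (measure_ge0 P _) (tail 1 ltr01).
  by rewrite powR1 mulr1 lee_fin.
apply: (le_trans (wasserstein_le_coupling p mU mV margU margV)).
rewrite -poweR_EFin; apply: gt0_ler_poweR.
- by rewrite invr_ge0 ltW.
- rewrite in_itv/= leey andbT; apply: integral_ge0 => w _.
  by rewrite lee_fin powR_ge0.
- by rewrite in_itv/= leey andbT lee_fin ltW// moment_constant_gt0.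
- apply: moment_le_of_tail => //; first exact: mW.
  by move=> w; exact: sqrtr_ge0.
Qed.
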